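(* Let $G_1$ and $G_2$ be graphs such that $\mathrm{obs}_{\mathrm{out}}(G_1) > 1$ and $\mathrm{obs}_{\mathrm{out}}(G_2) > 1$. Then $\mathrm{obs}(G_1 \mathbin{\dot{\cup}} G_2) > 1$, where $G_1 \mathbin{\dot{\cup}} G_2$ denotes the disjoint union of $G_1$ and $G_2$.
   Context: All graphs are finite, simple, and undirected. A straight-line drawing of a graph $G$ in the plane places the vertices at distinct points of $\mathbb{R}^2$ and draws each edge as the closed line segment joining its endpoints; the drawing is regarded as the union of all vertex points and edge segments. A non-edge of $G$ is a pair of distinct vertices $a,b$ such that $ab$ is not an edge of $G$; in a drawing it is identified with the line segment joining $a$ and $b$. An obstacle representation of $G$ is a straight-line drawing of $G$ in the plane together with a collection of connected subsets of the plane, called obstacles, such that no obstacle meets the drawing of $G$, while every non-edge of $G$ intersects at least one obstacle. The obstacle number $\mathrm{obs}(G)$ is the least number of obstacles in an obstacle representation of $G$. An outside obstacle is an obstacle contained in the unbounded component of the complement of the drawing of $G$. The outside obstacle number $\mathrm{obs}_{\mathrm{out}}(G)$ is the least number of obstacles in an obstacle representation of $G$ in which one of the obstacles is an outside obstacle, or zero if $\mathrm{obs}(G)=0$. *)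

(* Defs.v *)
From HB Require Import structures.
From mathcomp Require Import all_boot all_order all_algebra.
From mathcomp Require Import all_classical all_reals all_analysis.
From mathcomp Require Import ring lra.
Set Implicit Arguments.
Unset Strict Implicit.
Unset Printing Implicit Defensive.
Import Order.TTheory GRing.Theory Num.Theory.
Import numFieldNormedType.Exports.
Local Open Scope classical_set_scope.
Local Open Scope ring_scope.

Record sgraph := SGraph {
  vertex :> finType;
  adj : rel vertex;
  adj_sym : symmetric adj;
  adj_irrefl : irreflexive adj }.

Arguments adj {s} _ _ : rename.

Definition nonedge (G : sgraph) (a b : G) : bool := (a != b) && ~~ adj a b.

Section DisjointUnion.
Variables G1 G2 : sgraph.

Definition dunion_adj (u v : (G1 + G2)%type) : bool :=
  match u, v with
  | inl a, inl b => adj a b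
  | inr a, inr b => adj a b
  | _, _ => false
  end.

Lemma dunion_adj_sym : symmetric dunion_adj.
Proof. by move=> [a|a] [b|b] //=; rewrite adj_sym. Qed.

Lemma dunion_adj_irrefl : irreflexive dunion_adj.
Proof. by move=> [a|a] /=; rewrite adj_irrefl. Qed.

Definition dunion : sgraph := SGraph dunion_adj_sym dunion_adj_irrefl.

End DisjointUnion.

Section Obstacles.
Variable R : realType.

Local Notation plane := (R * R)%type.

Definition segment (x y : plane) : set plane :=
  [set (1 - t) *: x + t *: y | t in `[0, 1]%classic].

Definition drawing (G : sgraph) (p : G -> plane) : set plane :=
  range p `|`
  \bigcup_(e in [set e : G * G | adj e.1 e.2]) segment (p e.1) (p e.2).

Definition obstacle_representation (G : sgraph) (p : G -> plane) (k : nat)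
    (O : 'I_k -> set plane) : Prop :=
  [/\ injective p,
      forall i, connected (O i),
      forall i, O i `&` drawing p = set0 &
      forall a b : G, nonedge a b ->
        exists i, segment (p a) (p b) `&` O i !=set0].

(* In the plane, the complement of a drawing (a compact set) has exactly one
   unbounded component, so [C] below is that component. *)
Definition outside (G : sgraph) (p : G -> plane) (A : set plane) : Prop :=
  exists2 C : set plane,
    (exists2 x, (~` drawing p) x & C = connected_component (~` drawing p) x) /\
    ~ bounded_set C &
    A `<=` C.

Definition has_obstacle_representation (G : sgraph) : pred nat := fun k =>
  `[< exists (p : G -> plane) (O : 'I_k -> set plane),
        obstacle_representation p O >].

Definition has_outside_obstacle_representation (G : sgraph) : pred nat :=
  fun k =>
  `[< exists (p : G -> plane) (O : 'I_k -> set plane),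
        obstacle_representation p O /\ exists i, outside p (O i) >].

Section Existence.
Variable G : sgraph.

(* Vertices are placed on the parabola y = x^2, and each non-edge is blocked
   by a one-point obstacle. *)
Let px (a : G) : R := (enum_rank a)%:R.
Let par (a : G) : plane := (px a, px a ^+ 2).
Let out : plane := (0, -1).

Let px_inj : injective px.
Proof.
by move=> a b /eqP; rewrite /px eqr_nat => /eqP /val_inj /enum_rank_inj.
Qed.

Let par_inj : injective par.
Proof. by move=> a b [/px_inj]. Qed.

Let segment_coord (x y z : plane) : segment x y z -> exists2 t : R,
  (0 <= t <= 1) & z.1 = (1 - t) * x.1 + t * y.1 /\
                  z.2 = (1 - t) * x.2 + t * y.2.
Proof. by case=> t /=; rewrite in_itv /= => t01 <-; exists t. Qed.

Let drawing_segment z : drawing par z ->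
  exists c d, (c = d \/ adj c d) /\ segment (par c) (par d) z.
Proof.
case=> [[c _ <-]|[[c d] /= cd zcd]]; last by exists c, d; split; [right|].
exists c, c; split; first by left.
by exists 0; [rewrite /= in_itv /= lexx ler01|rewrite subr0 scale1r scale0r addr0].
Qed.

Let drawing_ge0 z : drawing par z -> 0 <= z.2.
Proof.
case/drawing_segment=> c [d [_ /segment_coord[t /andP[t0 t1] [_ ->]]]] /=.
by rewrite addr_ge0 // mulr_ge0 ?sqr_ge0 // subr_ge0.
Qed.

Let seg (a b : G) (t : R) : plane := (1 - t) *: par a + t *: par b.

Let seg_uniq (a b c d : G) s t : nonedge a b -> c = d \/ adj c d ->
  segment (par c) (par d) (seg a b s) ->
  segment (par c) (par d) (seg a b t) -> s = t.
Proof.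
move=> /andP[ab nab] cd /segment_coord[u _ [/= u1 u2]].
move=> /segment_coord[v _ [/= v1 v2]].
have abx : px b - px a != 0 by rewrite subr_eq0 (inj_eq px_inj) eq_sym.
have [//|st] := eqVneq s t.
pose f (x y : R) := y - (px a + px b) * x + px a * px b.
have fE w w' : (1 - w') * px a + w' * px b = (1 - w) * px c + w * px d ->
  (1 - w') * px a ^+ 2 + w' * px b ^+ 2 =
    (1 - w) * px c ^+ 2 + w * px d ^+ 2 ->
  (1 - w) * ((px c - px a) * (px c - px b)) +
    w * ((px d - px a) * (px d - px b)) = 0.
  move=> e1 e2.
  transitivity (((1 - w) * px c ^+ 2 + w * px d ^+ 2)
    - (px a + px b) * ((1 - w) * px c + w * px d) + px a * px b); first by ring.
  by rewrite -e1 -e2; ring.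
have fu := fE _ _ u1 u2; have fv := fE _ _ v1 v2.
have uv : u - v != 0.
  apply/eqP => /eqP; rewrite subr_eq0 => /eqP uv; subst v.
  have : (s - t) * (px b - px a) = 0.
    transitivity (((1 - s) * px a + s * px b) - ((1 - t) * px a + t * px b)).
      by ring.
    by rewrite u1 v1 subrr.
  by move/eqP; rewrite mulf_eq0 subr_eq0 (negPf st) (negPf abx).
set F := (px c - px a) * (px c - px b) in fu fv.
set H := (px d - px a) * (px d - px b) in fu fv.
have HF : H - F = 0.
  apply: (mulfI uv); rewrite mulr0.
  transitivity (((1 - u) * F + u * H) - ((1 - v) * F + v * H)); first by ring.
  by rewrite fu fv subrr.
have F0 : F = 0.
  transitivity (((1 - u) * F + u * H) - u * (H - F)); first by ring.
  by rewrite fu HF mulr0 subrr.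
have H0 : H = 0 by rewrite -(subrK F H) HF F0 addr0.
have on e : (px e - px a) * (px e - px b) = 0 -> e = a \/ e = b.
  move/eqP; rewrite mulf_eq0 !subr_eq0 !(inj_eq px_inj).
  by move=> /orP[]/eqP; [left|right].
have cdx : c <> d.
  move=> ecd; move: u1 v1; rewrite ecd => u1 v1.
  have : (s - t) * (px b - px a) = 0.
    transitivity (((1 - s) * px a + s * px b) - ((1 - t) * px a + t * px b)).
      by ring.
    by rewrite u1 v1; ring.
  by move/eqP; rewrite mulf_eq0 subr_eq0 (negPf st) (negPf abx).
case: cd => // cd.
case: (on c F0) (on d H0) => ec [] ed; move: cd cdx nab;
  rewrite ec ed //; first by move=> ->.
by rewrite adj_sym => ->.
Qed.

Let free_point (a b : G) : nonedge a b ->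
  exists2 z, segment (par a) (par b) z & ~ drawing par z.
Proof.
move=> nab.
pose bad (e : G * G) := [set n : nat | (e.1 = e.2 \/ adj e.1 e.2) /\
  segment (par e.1) (par e.2) (seg a b (n.+1%:R^-1))].
have badf : finite_set (\bigcup_(e in [set: G * G]) bad e).
  apply: bigcup_finite => // e _.
  have [->|/set0P[m [em sm]]] := eqVneq (bad e) set0; first exact: finite_set0.
  apply: (@sub_finite_set _ _ [set m]); last exact: finite_set1.
  move=> n [_ sn] /=.
  have /invr_inj/eqP := seg_uniq nab em sn sm.
  by rewrite eqr_nat eqSS => /eqP.
have [n nbad] : exists n, ~ (\bigcup_(e in [set: G * G]) bad e) n.
  apply/existsNP => allbad; apply: infinite_nat.
  by apply: sub_finite_set badf => n _; exact: allbad.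
exists (seg a b (n.+1%:R^-1)).
  exists (n.+1%:R^-1) => //=.
  by rewrite in_itv /= invr_ge0 ler0n /= invf_le1 ?ltr0n // ler1n.
move=> /drawing_segment[c [d cd]]; apply: nbad.
by exists (c, d).
Qed.

Let out_free : ~ drawing par out.
Proof. by move/drawing_ge0 => /=; rewrite lerNr oppr0 ler10. Qed.

Let out_outside : outside par [set out].
Proof.
exists (connected_component (~` drawing par) out); last first.
  by move=> _ ->; exact: connected_component_refl.
split; first by exists out.
pose ray := (fun y : R => (0, y) : plane) @` `]-oo, 0[%classic.
have ray_comp : ray `<=` connected_component (~` drawing par) out.
  apply: connected_component_max.
  - by exists (-1) => //=; rewrite in_itv /= ltrN10.
  - move=> z [y /= + <-]; rewrite in_itv /= => y0 /drawing_ge0 /=.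
    by rewrite leNgt y0.
  - apply: connected_continuous_connected.
      by apply/connected_intervalP; exact: interval_is_interval.
    apply: continuous_subspaceT => y.
    by apply: (@cvg_pair _ _ _ _ (nbhs (0 : R)) (nbhs y));
      [exact: cvg_cst|exact: cvg_id].
move=> /pinfty_ex_gt0[M M0 bM].
have : `|(0, - (M + 1)) : plane| <= M.
  apply: bM; apply: ray_comp; exists (- (M + 1)) => //=.
  by rewrite in_itv /= oppr_lt0 ltr_wpDr.
rewrite prod_normE /= ge_max normrN => /andP[_].
by move=> /(le_trans (ler_norm _)); rewrite leNgt ltrDl ltr01.
Qed.

Lemma outside_obstacle_representation_exists :
  exists k, has_outside_obstacle_representation G k.
Proof.
pose pt (e : option (G * G)) : plane :=
  if e is Some (a, b) then
    if pselect (nonedge a b) is left h then s2val (cid2 (free_point h))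
    else out
  else out.
have ptP e : ~ drawing par (pt e).
  case: e => [[a b]|]; rewrite /pt /=; last exact: out_free.
  by case: pselect => [h|_]; [case: cid2|exact: out_free].
exists #|{: option (G * G)}|; apply/asboolP.
exists par, (fun i => [set pt (enum_val i)]); split; last first.
  by exists (enum_rank None); rewrite enum_rankK.
split; first exact: par_inj.
- by move=> i; exact: connected1.
- by move=> i; rewrite -subset0 => z [/= ->]; exact: ptP.
- move=> a b nab; exists (enum_rank (Some (a, b))).
  exists (pt (Some (a, b))); split; last by rewrite /= enum_rankK.
  by rewrite /pt; case: pselect => // h; case: cid2.
Qed.

Lemma obstacle_representation_exists :
  exists k, has_obstacle_representation G k.
Proof.
have [k /asboolP[p [obst [pO _]]]] := outside_obstacle_representation_exists.
by exists k; apply/asboolP; exists p, obst.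
Qed.

End Existence.

Definition obs (G : sgraph) : nat := ex_minn (obstacle_representation_exists G).

Definition obs_out (G : sgraph) : nat :=
  if obs G == 0%N then 0%N
  else ex_minn (outside_obstacle_representation_exists G).

End Obstacles.

(* Main.v *)
Require Import Defs.
From mathcomp Require Import all_boot all_order all_algebra.
From mathcomp Require Import all_classical all_reals all_analysis.
From mathcomp Require Import ring lra.

(** The plane is ordered lexicographically.  A segment lies between its
    endpoints for this order, hence every drawing lies below its largest
    vertex [c], and the points above [c] form a connected unbounded set that
    misses the drawing: whatever meets it is in the outer face
    ([above_outside]).

    Consider a representation of the disjoint union by at most one obstacle.
    Both parts have vertices; call [c1] and [c2] their largest ones and suppose,
    by symmetry, that [c2 < c1].  The vertices [c1] and [c2] form a non-edge, so
    there is an obstacle [O], and it contains a point [z] of their segment; [z]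
    is not [c2], a point of the drawing, hence [z > c2].  So [O] meets the set of
    points above the second part and is an outside obstacle for that part alone:
    the outside obstacle number of the second graph is at most one
    ([obs_out_le1_below]). *)

Set Implicit Arguments.
Unset Strict Implicit.
Unset Printing Implicit Defensive.
Import Order.TTheory GRing.Theory Num.Theory.
Import numFieldNormedType.Exports.
Local Open Scope classical_set_scope.
Local Open Scope ring_scope.

Section LexicographicOrder.
Variable R : realType.
Local Notation plane := (R * R)%type.
Local Notation lplane := (R *l R)%type.

Lemma segmentC (x y : plane) : segment x y `<=` segment y x.
Proof.
move=> z [t /= + <-]; rewrite in_itv /= => /andP[t0 t1].
exists (1 - t); first by rewrite /= in_itv /= subr_ge0 t1 gerBl t0.
by rewrite subKr addrC.
Qed.

Lemma segment_endl (x y : plane) : segment x y x.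
Proof.
exists 0; first by rewrite /= in_itv /= lexx ler01.
by rewrite subr0 scale1r scale0r addr0.
Qed.

Lemma segment_endr (x y : plane) : segment x y y.
Proof. exact/segmentC/segment_endl. Qed.

Lemma segment_connected (x y : plane) : connected (segment x y).
Proof.
apply: connected_continuous_connected.
  by apply/connected_intervalP; exact: interval_is_interval.
apply: continuous_subspaceT => t.
apply: cvgD; apply: cvgZr_tmp; last exact: cvg_id.
by apply: cvgB; [exact: cvg_cst|exact: cvg_id].
Qed.

(** If [z = x + t (y - x)] with [x <= y], then [z - x = t (y - x)] and
    [y - z = (1 - t) (y - x)] are lexicographically nonnegative. *)
Lemma segment_lexi (x y z : lplane) : segment x y z ->
  (Order.min x y <= z <= Order.max x y)%O.
Proof.
wlog xy : x y / (x <= y)%O => [below|].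
  have /orP[/below//|yx /segmentC] := le_total x y.
  by move=> /(below _ _ yx); rewrite minC maxC.
rewrite (min_idPl xy) (max_idPr xy).
case=> /= t; rewrite in_itv /= => + <-.
move: (t : R) => {}t /andP[t0 t1].
move: x y xy => [x1 x2] [y1 y2]; rewrite !leEprodlexi /= => /andP[xy1 xy2].
have e (u v : R) : (1 - t) *: u + t *: v = u + t * (v - u).
  by rewrite /GRing.scale /=; ring.
have yz (u v : R) : v - (u + t * (v - u)) = (1 - t) * (v - u) by ring.
have d1 : 0 <= y1 - x1 by rewrite subr_ge0.
have t1' : 0 <= 1 - t by rewrite subr_ge0.
rewrite !e -!(subr_ge0 _ y1) -!(subr_ge0 _ y2) !yz !lerDl gerDl.
rewrite (mulr_ge0 t0 d1) (mulr_ge0 t1' d1) /=.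
have [yx|xy] := leP y1 x1.
  have d2 : 0 <= y2 - x2 by rewrite subr_ge0 (implyP xy2).
  by rewrite (mulr_ge0 t0 d2) (mulr_ge0 t1' d2) !implybT.
apply/andP; split; apply/implyP => h.
  (* As [x1 < y1], only an endpoint shares its first coordinate with [x] or
     [y]. *)
  have -> : t = 0 by nra.
  by rewrite mul0r.
have -> : t = 1 by nra.
by rewrite subrr mul0r.
Qed.

Lemma drawing_segment (G : sgraph) (p : G -> plane) z : drawing p z ->
  exists a b, segment (p a) (p b) z.
Proof.
by case=> [[a _ <-]|[[a b] _ /= abz]];
  [exists a, a; exact: segment_endl|exists a, b].
Qed.

(** A point [z] above the upper bound [c] of the vertices is joined to every
    point above [c] by a segment that stays above [c], hence off the drawing; the
    points above [c] include a vertical ray. *)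
Lemma above_outside (G : sgraph) (p : G -> plane) (c : lplane) (O : set plane)
    (z : lplane) : (forall a, (p a : lplane) <= c)%O ->
  connected O -> O `&` drawing p = set0 -> O z -> (c < z)%O -> outside p O.
Proof.
move=> pc Oconn Op Oz cz.
have above (w : lplane) : (c < w)%O -> ~ drawing p w.
  move=> cw /drawing_segment[a [b /segment_lexi/andP[_ wab]]].
  have : (w <= c)%O by rewrite (le_trans wab) // ge_max !pc.
  by rewrite leNgt cw.
have comp (w : lplane) : (c < w)%O -> connected_component (~` drawing p) z w.
  move=> cw; have : segment z w w by exact: segment_endr.
  apply: connected_component_max; [exact: segment_endl| |].
    move=> u /segment_lexi/andP[zwu _]; apply: above.
    by rewrite (lt_le_trans _ zwu) // lt_min cz.
  exact: segment_connected.
exists (connected_component (~` drawing p) z); last first.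
  apply: connected_component_max => // w Ow dw.
  by have : set0 w by rewrite -Op.
split; first by exists z => //; exact: above.
move=> /pinfty_ex_gt0[M M0 bM].
have : `|(c.1, `|c.2| + M + 1) : plane| <= M.
  apply/bM/comp; rewrite ltEprodlexi /= lexx /= -addrA.
  by rewrite (le_lt_trans (ler_norm _)) // ltrDl addr_gt0.
rewrite prod_normE /= ge_max => /andP[_ /(le_trans (ler_norm _))].
by rewrite leNgt -addrA ltr_wpDl // ltrDl ltr01.
Qed.

End LexicographicOrder.

Lemma obs_out_le_outside (R : realType) (G : sgraph) k :
  has_outside_obstacle_representation R G k -> (obs_out R G <= k)%N.
Proof.
by rewrite /obs_out; case: eqP => // _; case: ex_minnP => m _; apply.
Qed.

(** The map [f] identifies [G] with an induced subgraph of [H]. *)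
Section Restriction.
Variables (R : realType) (G H : sgraph) (f : G -> H).
Hypothesis f_inj : injective f.
Hypothesis f_adj : forall a b, adj (f a) (f b) = adj a b.

Lemma drawing_restrict (p : H -> R * R) : drawing (p \o f) `<=` drawing p.
Proof.
move=> z [[a _ <-]|[[a b] /= ab abz]]; first by left; exists (f a).
by right; exists (f a, f b) => //=; rewrite f_adj.
Qed.

Lemma obstacle_representation_restrict (p : H -> R * R) k
    (O : 'I_k -> set (R * R)) :
  obstacle_representation p O -> obstacle_representation (p \o f) O.
Proof.
case=> p_inj Oconn Op pO; split=> //; first exact: inj_comp.
- move=> i; apply: subsetI_eq0 (Op i) => //; exact: drawing_restrict.
- move=> a b /andP[ab nab]; apply: pO.
  by rewrite /nonedge (inj_eq f_inj) ab f_adj.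
Qed.

(** The segment from the largest vertex [f c] of the part [G] to a larger vertex
    [v] lies above [p (f c)] except for its end [p (f c)], which is in the
    drawing; so the obstacle that blocks this non-edge has a point above the
    drawing of [G]. *)
Lemma obs_out_le1_below (p : H -> R * R) k (O : 'I_k -> set (R * R))
    (c : G) (v : H) : (k <= 1)%N -> obstacle_representation p O ->
  (forall a, (p (f a) : R *l R) <= p (f c))%O ->
  ((p (f c) : R *l R) <= p v)%O -> nonedge v (f c) ->
  (obs_out R G <= 1)%N.
Proof.
move=> k1 rep pc cv vc; apply: leq_trans k1.
apply: obs_out_le_outside; apply/asboolP; exists (p \o f), O.
have [_ Oconn Op pO] := rep.
have rep' := obstacle_representation_restrict rep; split => //.
have [_ _ Op' _] := rep'.
have [i [z [vcz Oz]]] := pO _ _ vc; exists i.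
apply: (above_outside pc _ _ Oz) => //.
have /andP[cz _] := segment_lexi vcz.
rewrite (min_idPr cv) in cz.
rewrite lt_neqAle cz andbT; apply/eqP => zc.
have : set0 z by rewrite -(Op i); split => //; rewrite -zc; left; exists (f c).
by [].
Qed.

End Restriction.

(** The graph without vertices is represented with no obstacle at all, so that
    its outside obstacle number is zero by convention. *)
Lemma obs_out_gt0_vertex (R : realType) (G : sgraph) :
  (0 < obs_out R G)%N -> inhabited G.
Proof.
rewrite /obs_out; case: eqP => // G0 _.
case: (pselect (inhabited G)) => // nG; case: G0.
rewrite /obs; case: ex_minnP => m _ /(_ 0%N) m0.
suff : has_obstacle_representation R G 0 by move=> /m0; rewrite leqn0 => /eqP.
have vG (a : G) : False by apply: nG; constructor.
apply/asboolP; exists (fun=> 0), (fun=> set0).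
by split=> [a|[]|[]|a] //; case: (vG a).
Qed.

Theorem lemma4p1 (R : realType) (G1 G2 : sgraph)
  (h1 : (1 < obs_out R G1)%N) (h2 : (1 < obs_out R G2)%N) :
  (1 < obs R (dunion G1 G2))%N.
Proof.
have [a0] := obs_out_gt0_vertex (ltnW h1).
have [b0] := obs_out_gt0_vertex (ltnW h2).
rewrite ltnNge; apply/negP.
rewrite /obs; case: ex_minnP => k /asboolP[p [obst rep]] _ k1.
pose q u : R *l R := p u.
case: (@arg_maxP _ _ _ a0 predT (q \o inl)) => // a _ qa.
case: (@arg_maxP _ _ _ b0 predT (q \o inr)) => // b _ qb.
have [ab|/ltW ba] := leP (q (inl a)) (q (inr b)).
- move: h1; rewrite ltnNge => /negP; apply.
  apply: (@obs_out_le1_below R G1 (dunion G1 G2) inl _ _ p k obst a (inr b)) => //.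
  + by move=> x y [].
  + by move=> x; exact: qa.
- move: h2; rewrite ltnNge => /negP; apply.
  apply: (@obs_out_le1_below R G2 (dunion G1 G2) inr _ _ p k obst b (inl a)) => //.
  + by move=> x y [].
  + by move=> x; exact: qb.
Qed.
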